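(* For every $M>0$ there exists a socle-vector $s$ such that the set of $h$-vectors admissible for the pair $(3,s)$ has more than $M$ different relative maxima.
   Context: Fix a field $k$ of characteristic zero. An algebra means a standard graded artinian algebra $A=R/I=\bigoplus_{i=0}^e A_i$, where $R=k[x_1,\dots,x_r]$ with all $x_i$ of degree $1$, $I$ is a homogeneous ideal containing no non-zero forms of degree $1$, and $e$ is the last index with $A_e\neq 0$. The embedding dimension of $A$ is $r$. The $h$-vector of $A$ is $h(A)=(1,h_1,\dots,h_e)$ with $h_i=\dim_k A_i$ (so $h_1=r$). The socle of $A$ is $soc(A)=\{a\in A \mid a\,\overline{m}=0\}$, where $\overline{m}$ is the maximal homogeneous ideal of $A$; it is a homogeneous ideal, and the socle-vector of $A$ is $s(A)=(s_0,\dots,s_e)$ with $s_i=\dim_k soc(A)_i$ (so $s_0=0$ and $s_e=h_e>0$). An $h$-vector $h$ is admissible for the pair $(r,s)$ if there exists an algebra $A$ of embedding dimension $r$ with $s(A)=s$ and $h(A)=h$. $h$-vectors of the same length are partially ordered entrywise: $h\geq h'$ if every entry of $h$ is $\geq$ the corresponding entry of $h'$. Two admissible $h$-vectors $h,h'$ for $(r,s)$ are comparable if $h\geq h'$ or $h'>h$. An admissible $h$-vector $h$ for $(r,s)$ is a relative maximum (for the set of all $h$-vectors admissible for $(r,s)$) if $h\geq h'$ for every other admissible $h'$ which is comparable with $h$. *)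

(* Defs.v *)
From HB Require Import structures.
From mathcomp Require Import all_boot all_order all_algebra.
From mathcomp Require Import mpoly.

Set Implicit Arguments.
Unset Strict Implicit.
Unset Printing Implicit Defensive.

Import GRing.Theory.
Local Open Scope ring_scope.
Local Open Scope quotient_scope.

(* The quotient ring R/I of R = k[x_0, ..., x_{r-1}], which ring_quotient
   equips only with a ring structure, is made here into a k-module.           *)
Definition quot_alg (k : fieldType) (r : nat) (I : idealr {mpoly k[r]}) : Type :=
  {ideal_quot I}.

HB.instance Definition _ (k : fieldType) (r : nat) (I : idealr {mpoly k[r]}) :=
  GRing.ComNzRing.on (quot_alg I).

Definition qproj (k : fieldType) (r : nat) (I : idealr {mpoly k[r]})
  (f : {mpoly k[r]}) : quot_alg I := \pi_{ideal_quot I} f.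

Section QuotientModule.
Variables (k : fieldType) (r : nat) (I : idealr {mpoly k[r]}).

Lemma qproj_is_zmod_morphism : zmod_morphism (@qproj k r I).
Proof. exact: (rmorphB (\pi_{ideal_quot I})). Qed.
HB.instance Definition _ :=
  GRing.isZmodMorphism.Build {mpoly k[r]} (quot_alg I) (@qproj k r I)
    qproj_is_zmod_morphism.

Lemma qproj_is_monoid_morphism : monoid_morphism (@qproj k r I).
Proof.
split; first exact: (rmorph1 (\pi_{ideal_quot I})).
exact: (rmorphM (\pi_{ideal_quot I})).
Qed.
HB.instance Definition _ :=
  GRing.isMonoidMorphism.Build {mpoly k[r]} (quot_alg I) (@qproj k r I)
    qproj_is_monoid_morphism.

Definition qscale (c : k) (a : quot_alg I) : quot_alg I := qproj I c%:MP * a.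

Lemma qscaleA a b v : qscale a (qscale b v) = qscale (a * b) v.
Proof. by rewrite /qscale mulrA mpolyCM rmorphM. Qed.
Lemma qscale1 : left_id 1 qscale.
Proof. by move=> v; rewrite /qscale rmorph1 mul1r. Qed.
Lemma qscaleDr : right_distributive qscale +%R.
Proof. by move=> a u v; rewrite /qscale mulrDr. Qed.
Lemma qscaleDl v : {morph qscale^~ v : a b / a + b}.
Proof. by move=> a b; rewrite /qscale mpolyCD rmorphD mulrDl. Qed.

HB.instance Definition _ := GRing.Zmodule_isLmodule.Build k (quot_alg I)
  qscaleA qscale1 qscaleDr qscaleDl.

Lemma qprojZ (c : k) f : qproj I (c *: f) = c *: qproj I f.
Proof. by rewrite -mul_mpolyC rmorphM. Qed.

Lemma qproj_eq0 f : (qproj I f == 0) = (f \in I).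
Proof. by rewrite -(raddf0 (@qproj k r I)) /qproj -Quotient.idealrBE subr0. Qed.

End QuotientModule.

Section Algebras.
Variable k : fieldType.

(* U is meant to be a k-subspace of V. *)
Definition has_dim (V : lmodType k) (U : V -> Prop) (n : nat) : Prop :=
  exists v : 'I_n -> V,
    [/\ forall i, U (v i),
        forall c : 'I_n -> k, \sum_i c i *: v i = 0 -> forall i, c i = 0
      & forall u, U u -> exists c : 'I_n -> k, u = \sum_i c i *: v i].

Section Quotient.
Variables (r : nat) (I : idealr {mpoly k[r]}).

Definition graded_piece (i : nat) (a : quot_alg I) : Prop :=
  exists2 f : {mpoly k[r]}, f \is i.-homog & a = qproj I f.

Definition max_hideal (a : quot_alg I) : Prop :=
  exists2 f : {mpoly k[r]}, f@_0%MM = 0 & a = qproj I f.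

Definition socle (a : quot_alg I) : Prop :=
  forall m, max_hideal m -> a * m = 0.

Definition socle_piece (i : nat) (a : quot_alg I) : Prop :=
  socle a /\ graded_piece i a.

End Quotient.

(* An idealr is a proper ideal, so the quotient is never zero.  Given that the
   ideal is homogeneous, sga_top says that A is the direct sum of its graded
   pieces A_0, ..., A_e with A_e nonzero; this is where A is artinian.       *)
Record sg_artinian (r : nat) := SGArtinian {
  sga_ideal : idealr {mpoly k[r]};
  sga_homog : forall f (d : nat),
    f \in sga_ideal -> pihomog mdeg d f \in sga_ideal;
  sga_nolin : forall f, f \is 1.-homog -> f \in sga_ideal -> f = 0;
  sga_e : nat;
  sga_e_neq0 : exists2 a : quot_alg sga_ideal, graded_piece sga_e a & a != 0;
  sga_top : forall (i : nat) (a : quot_alg sga_ideal),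
    (sga_e < i)%N -> graded_piece i a -> a = 0
}.

Definition is_hvector (r : nat) (A : sg_artinian r) (h : seq nat) : Prop :=
  size h = (sga_e A).+1 /\
  forall i, (i < size h)%N ->
    has_dim (@graded_piece r (sga_ideal A) i) (nth 0%N h i).

Definition is_socle_vector (r : nat) (A : sg_artinian r) (s : seq nat) : Prop :=
  size s = (sga_e A).+1 /\
  forall i, (i < size s)%N ->
    has_dim (@socle_piece r (sga_ideal A) i) (nth 0%N s i).

Definition admissible (r : nat) (s h : seq nat) : Prop :=
  exists A : sg_artinian r, is_socle_vector A s /\ is_hvector A h.

(* all2 also forces both vectors to have the same length. *)
Definition hge (h h' : seq nat) : bool := all2 geq h h'.

Definition hcomparable (h h' : seq nat) : bool :=
  hge h h' || (hge h' h && (h' != h)).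

Definition relative_maximum (r : nat) (s h : seq nat) : Prop :=
  admissible r s h /\
  forall h', admissible r s h' -> h' != h -> hcomparable h h' -> hge h h'.

End Algebras.

(* Main.v *)
(* Let s have entry S > 0 in degree i, entry 1 in degree e = 3i + 3 and 0
   elsewhere, and let h be admissible for (3, s).  Put d = 2i + 2, so that
   e = i + d + 1.  Multiplication A_{d+1} x R_i -> A_e is nondegenerate on the
   left because A has no socle in the degrees strictly between i and e, and it
   kills the lifts of the socle of degree i, so h_{d+1} <= C(i+2,2) - S.  Choose
   a point P of the plane at which a form of degree i lifting a socle element
   does not vanish, and two linear forms x, y cutting out P.  Then
   R_j = (x,y) R_{j-1} + I_j for j > i, and the Koszul complex
   A_d -> A_{d+1}^2 -> A_{d+2} of x, y is injective on the left and surjective on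
   the right; hence h_d + h_{d+2} <= 2 h_{d+1} <= 2 C(i+2,2) - 2 S.

   On the other hand let S = C(a+b,2) + C(a-b,2), and truncate the monomial
   complete intersection (x^p, y^q, z^r), with p = i+2-(a+b), q = i+2-(a-b),
   r = e+3-p-q, to degrees > i.  The quotient has socle vector s, with
   h_d = C(i+3,2) - S - 2a and h_{d+2} = C(i+1,2) - S + 2a - 2.  Since
   C(i+3,2) + C(i+1,2) = 2 C(i+2,2) + 1, no admissible h-vector dominates two of
   these for different values of a.  So it suffices to take S with many such
   representations, and to take a relative maximum above each h-vector. *)

Require Import Defs.
From HB Require Import structures.
From mathcomp Require Import all_boot all_order all_algebra.
From mathcomp Require Import mpoly zify.
From Stdlib Require Import Classical.

Set Implicit Arguments.
Unset Strict Implicit.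
Unset Printing Implicit Defensive.

Import GRing.Theory.
Local Open Scope ring_scope.

(** * Dimension counts *)

Section Dimension.
Variable k : fieldType.

Lemma has_dim_iff (V : lmodType k) (U U' : V -> Prop) n :
  (forall u, U u <-> U' u) -> has_dim U n -> has_dim U' n.
Proof.
move=> UU' [v [Uv free_v gen_v]]; exists v; split=> // [i|u /UU'/gen_v //].
exact/UU'.
Qed.

Lemma linear_comb (V W : lmodType k) (f : {linear V -> W}) n (c : 'I_n -> k) v :
  f (\sum_i c i *: v i) = \sum_i c i *: f (v i).
Proof. by rewrite linear_sum; apply: eq_bigr => i _; rewrite linearZ. Qed.

(** With [f := id] this yields the coordinates of a family, otherwise the matrix of a map on a
    basis, acting on row vectors. *)
Lemma coord_matrix (V W : lmodType k) (U : W -> Prop) n (v : 'I_n -> W) m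
    (f : V -> W) (w : 'I_m -> V) :
  (forall u, U u -> exists c : 'I_n -> k, u = \sum_i c i *: v i) ->
  (forall i, U (f (w i))) ->
  exists A : 'M[k]_(m, n), forall i, f (w i) = \sum_j A i j *: v j.
Proof.
move=> gen_v Ufw; have [c cP] := fin_all_exists (fun i => gen_v _ (Ufw i)).
by exists (\matrix_(i, j) c i j) => i; rewrite cP; under [RHS]eq_bigr do rewrite mxE.
Qed.

Lemma sum_mulmx (V : lmodType k) m n (v : 'I_n -> V) (x : 'rV[k]_m)
    (A : 'M_(m, n)) :
  \sum_i x 0 i *: (\sum_j A i j *: v j) = \sum_j (x *m A) 0 j *: v j.
Proof.
under eq_bigr do rewrite scaler_sumr.
rewrite exchange_big; apply: eq_bigr => j _.
by rewrite mxE scaler_suml; apply: eq_bigr => i _; rewrite scalerA.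
Qed.

Lemma row_free_inj m n (A : 'M[k]_(m, n)) :
  (forall x : 'rV_m, x *m A = 0 -> x = 0) -> row_free A.
Proof.
move=> injA; rewrite -kermx_eq0; apply/eqP/row_matrixP => i.
by rewrite row0; apply: injA; rewrite -row_mul mulmx_ker row0.
Qed.

Lemma free_le_dim (V : lmodType k) (U : V -> Prop) n m (t : 'I_m -> V) :
  has_dim U n -> (forall i, U (t i)) ->
  (forall c : 'I_m -> k, \sum_i c i *: t i = 0 -> forall i, c i = 0) -> (m <= n)%N.
Proof.
move=> [v [_ _ gen_v]] Ut free_t; have [T TP] := coord_matrix (f := id) gen_v Ut.
suff /eqP <- : row_free T by apply: rank_leq_col.
apply: row_free_inj => x xT; apply/rowP => j; rewrite mxE.
apply: (free_t (fun j => x 0 j)); under eq_bigr do rewrite TP.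
by rewrite sum_mulmx xT big1 // => l _; rewrite mxE scale0r.
Qed.

Definition subspace (V : lmodType k) (U : V -> Prop) :=
  U 0 /\ forall c u u', U u -> U u' -> U (c *: u + u').

Lemma subspace_sum (V : lmodType k) (U : V -> Prop) n (c : 'I_n -> k) v :
  subspace U -> (forall i, U (v i)) -> U (\sum_i c i *: v i).
Proof.
move=> [U0 UD] Uv; elim/big_ind: _ => // [u u' Uu Uu'|i _].
  by rewrite -[u]scale1r; apply: UD.
by rewrite -[_ *: _]addr0; apply: UD.
Qed.

(** Two matrices with zero product have ranks adding up to at most the middle dimension, here
    [n2 + n2]. Injectivity and surjectivity make these ranks [n1] and [n3]. *)
Lemma koszul_dim (V : lmodType k) (U1 U2 U3 : V -> Prop) n1 n2 n3
    (f g : {linear V -> V}) :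
  subspace U1 -> has_dim U1 n1 -> has_dim U2 n2 -> has_dim U3 n3 ->
  (forall u, U1 u -> U2 (f u)) -> (forall u, U1 u -> U2 (g u)) ->
  (forall u, U2 u -> U3 (f u)) -> (forall u, U2 u -> U3 (g u)) ->
  (forall u, f (g u) = g (f u)) ->
  (forall u, U1 u -> f u = 0 -> g u = 0 -> u = 0) ->
  (forall w, U3 w -> exists u1 u2, [/\ U2 u1, U2 u2 & w = f u1 + g u2]) ->
  (n1 + n3 <= n2 + n2)%N.
Proof.
move=> subU1 [v1 [U1v free1 gen1]] [v2 [U2v free2 gen2]] [v3 [U3v free3 gen3]].
move=> U12f U12g U23f U23g fgC inj surj.
have [A AP] := coord_matrix gen2 (fun i => U12f _ (U1v i)).
have [B BP] := coord_matrix gen2 (fun i => U12g _ (U1v i)).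
have [C CP] := coord_matrix gen3 (fun i => U23f _ (U2v i)).
have [D DP] := coord_matrix gen3 (fun i => U23g _ (U2v i)).
have fC (x : 'rV_n2) : f (\sum_i x 0 i *: v2 i) = \sum_j (x *m C) 0 j *: v3 j.
  by rewrite linear_comb -sum_mulmx; apply: eq_bigr => i _; rewrite CP.
have gD (x : 'rV_n2) : g (\sum_i x 0 i *: v2 i) = \sum_j (x *m D) 0 j *: v3 j.
  by rewrite linear_comb -sum_mulmx; apply: eq_bigr => i _; rewrite DP.
have eq3 (x y : 'rV_n3) :
    \sum_j x 0 j *: v3 j = \sum_j y 0 j *: v3 j -> x = y.
  move=> /eqP; rewrite -subr_eq0 -sumrB => /eqP xy.
  apply/rowP => j; apply/eqP; rewrite -subr_eq0; apply/eqP.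
  apply: (free3 (fun j => x 0 j - y 0 j)); rewrite -[RHS]xy.
  by apply: eq_bigr => l _; rewrite scalerBl.
have rowv2 i : f (v1 i) = \sum_j row i A 0 j *: v2 j.
  by rewrite AP; apply: eq_bigr => j _; rewrite mxE.
have rowv2g i : g (v1 i) = \sum_j row i B 0 j *: v2 j.
  by rewrite BP; apply: eq_bigr => j _; rewrite mxE.
(* The complex V1 -> V2^2 -> V3, u |-> (g u, - f u), (u1, u2) |-> f u1 + g u2. *)
have compl0 : row_mx B (- A) *m col_mx C D = 0.
  rewrite mul_row_col mulNmx; apply/eqP; rewrite subr_eq0; apply/eqP.
  apply/row_matrixP => i; rewrite !row_mul; apply: eq3.
  by rewrite -fC -gD -rowv2 -rowv2g.
have rk1 : \rank (row_mx B (- A)) = n1.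
  apply/eqP; apply: row_free_inj => x; rewrite mul_mx_row => /eqP.
  rewrite row_mx_eq0 mulmxN oppr_eq0 => /andP[/eqP xB /eqP xA].
  apply/rowP => j; rewrite mxE; apply: (free1 (fun j => x 0 j)).
  apply: inj; first exact: subspace_sum.
    rewrite linear_comb; under eq_bigr do rewrite AP.
    by rewrite sum_mulmx xA big1 // => i _; rewrite mxE scale0r.
  rewrite linear_comb; under eq_bigr do rewrite BP.
  by rewrite sum_mulmx xB big1 // => i _; rewrite mxE scale0r.
have rk2 : \rank (col_mx C D) = n3.
  apply/eqP; rewrite eqn_leq rank_leq_col -{1}(mxrank1 k n3).
  apply/mxrankS/row_subP => l; have [u1 [u2 [Uu1 Uu2 e]]] := surj _ (U3v l).
  have [c1 c1P] := gen2 _ Uu1; have [c2 c2P] := gen2 _ Uu2.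
  have -> : row l 1%:M = row_mx (\row_j c1 j) (\row_j c2 j) *m col_mx C D.
    rewrite mul_row_col; apply: eq3.
    transitivity (v3 l).
      rewrite (bigD1 l) //= !mxE eqxx scale1r big1 ?addr0 // => j jl.
      by rewrite !mxE eq_sym (negPf jl) scale0r.
    have -> : v3 l = f (\sum_j (\row_j c1 j) 0 j *: v2 j) +
                     g (\sum_j (\row_j c2 j) 0 j *: v2 j).
      by rewrite e c1P c2P; congr (f _ + g _); apply: eq_bigr => j _; rewrite mxE.
    by rewrite fC gD -big_split; apply: eq_bigr => j _; rewrite !mxE scalerDl.
  exact: submxMl.
by have := mulmx0_rank_max compl0; rewrite rk1 rk2.
Qed.

(** The matrix [C] of the pairing has rank [n1] by left nondegeneracy, while the coordinates of the
    [t i] span [m] dimensions of its right kernel. *)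
Lemma pairing_dim (V1 V2 V3 : lmodType k) (U1 : V1 -> Prop) (U2 : V2 -> Prop)
    (U3 : V3 -> Prop) n1 n2 m (mu : V1 -> V2 -> V3) (t : 'I_m -> V2) :
  (forall w, linear (mu^~ w)) -> (forall u, linear (mu u)) ->
  subspace U1 -> has_dim U1 n1 -> has_dim U2 n2 -> has_dim U3 1 ->
  (forall u w, U1 u -> U2 w -> U3 (mu u w)) ->
  (forall u, U1 u -> (forall w, U2 w -> mu u w = 0) -> u = 0) ->
  (forall i, U2 (t i)) ->
  (forall c : 'I_m -> k, \sum_i c i *: t i = 0 -> forall i, c i = 0) ->
  (forall u i, U1 u -> mu u (t i) = 0) ->
  (n1 + m <= n2)%N.
Proof.
move=> lin1 lin2 subU1 [v1 [U1v free1 gen1]] [v2 [U2v _ gen2]] [v3 [_ free3 gen3]].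
move=> U3mu inj U2t free_t mut.
pose mu1 w : {linear V1 -> V3} := HB.pack (mu^~ w) (GRing.isLinear.Build _ _ _ _ _ (lin1 w)).
pose mu2 u : {linear V2 -> V3} := HB.pack (mu u) (GRing.isLinear.Build _ _ _ _ _ (lin2 u)).
have mu1E u w : mu u w = mu1 w u by [].
have mu2E u w : mu u w = mu2 u w by [].
have [C CP] : exists C : 'M[k]_(n1, n2),
    forall i j, mu (v1 i) (v2 j) = C i j *: v3 ord0.
  have [c cP] := fin_all_exists (fun ij => gen3 _ (U3mu _ _ (U1v ij.1) (U2v ij.2))).
  exists (\matrix_(i, j) c (i, j) ord0) => i j.
  by rewrite (cP (i, j)) big_ord1 mxE.
have [T TP] : exists T : 'M[k]_(m, n2), forall i, t i = \sum_j T i j *: v2 j.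
  exact: (coord_matrix (f := id) gen2 U2t).
have free3' c : c *: v3 ord0 = 0 -> c = 0.
  by move=> c0; apply: (free3 (fun=> c) _ ord0); rewrite big_ord1.
have CT0 : C *m T^T = 0.
  apply/matrixP => i j; rewrite !mxE; apply: free3'.
  rewrite -[RHS](mut _ j (U1v i)) TP mu2E linear_sum scaler_suml.
  by apply: eq_bigr => l _; rewrite linearZ_LR -mu2E CP scalerA mxE mulrC.
have rkC : \rank C = n1.
  apply/eqP; apply: row_free_inj => x xC.
  apply/rowP => j; rewrite mxE; apply: (free1 (fun j => x 0 j)).
  apply: inj; first exact: subspace_sum.
  move=> w /gen2[c ->]; rewrite mu2E linear_sum big1 // => l _.
  rewrite linearZ_LR -mu2E mu1E linear_sum.
  under eq_bigr do rewrite linearZ_LR -mu1E CP scalerA.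
  have := congr1 (fun M : 'rV_n2 => M 0 l) xC; rewrite !mxE -scaler_suml => ->.
  by rewrite scale0r scaler0.
have rkT : \rank T^T = m.
  rewrite mxrank_tr; apply/eqP; apply: row_free_inj => x xT.
  apply/rowP => j; rewrite mxE; apply: (free_t (fun j => x 0 j)).
  under eq_bigr do rewrite TP.
  by rewrite sum_mulmx xT big1 // => l _; rewrite mxE scale0r.
by have := mulmx0_rank_max CT0; rewrite rkC rkT.
Qed.

End Dimension.

(** * Ternary forms *)

Section Polynomials.
Variable k : fieldType.

Lemma mcoeff_span n (ms : seq 'X_{1..n}) (c : 'I_(size ms) -> k) (i : 'I_(size ms)) :
  uniq ms ->
  (\sum_j c j *: 'X_[nth 0%MM ms j])@_(nth 0%MM ms i) = c i.
Proof.
move=> uniq_ms; rewrite raddf_sum (bigD1 i) //= mcoeffZ mcoeffX eqxx mulr1.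
rewrite big1 ?addr0 // => j ji.
by rewrite mcoeffZ mcoeffX nth_uniq // (inj_eq val_inj) (negPf ji) mulr0.
Qed.

Lemma mpoly_span n (ms : seq 'X_{1..n}) (f : {mpoly k[n]}) :
  uniq ms -> {subset msupp f <= ms} ->
  f = \sum_(i < size ms) f@_(nth 0%MM ms i) *: 'X_[nth 0%MM ms i].
Proof.
move=> uniq_ms fms; apply/mpolyP => m; have [ms_m|ms_m] := boolP (m \in ms).
  rewrite -(nth_index 0%MM ms_m); have := ms_m; rewrite -index_mem => lt_m.
  by rewrite (mcoeff_span _ (Ordinal lt_m)).
rewrite raddf_sum /= (memN_msupp_eq0 (contra (fms m) ms_m)) big1 // => i _.
rewrite mcoeffZ mcoeffX; case: eqP => [e|]; last by rewrite mulr0.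
by rewrite -e mem_nth in ms_m.
Qed.

Definition mons d : seq 'X_{1..3} :=
  [seq s2m t | t : d.-tuple 'I_3 <- enum (basis 3 d)].

Lemma mem_mons d m : (m \in mons d) = (mdeg m == d).
Proof. by rewrite -basis_cover. Qed.

Lemma size_mons d : size (mons d) = 'C(d + 2, 2).
Proof. by rewrite size_basis -[RHS]bin_sub ?leq_addl // addnK. Qed.

Lemma uniq_mons d : uniq (mons d).
Proof. exact: uniq_basis. Qed.

Lemma homog_subset d (f : {mpoly k[3]}) : f \is d.-homog <-> {subset msupp f <= mons d}.
Proof.
split=> [/dhomog_mf hf m fm|fd]; first by rewrite mem_mons; apply/eqP/hf.
by apply/dhomogP => m /fd; rewrite mem_mons => /eqP.
Qed.

Lemma homog_dim d :
  has_dim (fun f : {mpoly k[3]} => f \is d.-homog) 'C(d + 2, 2).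
Proof.
rewrite -size_mons; exists (fun i => 'X_[nth 0%MM (mons d) i]).
split=> [i|c c0 i|f /homog_subset fd].
- by rewrite dhomogX -mem_mons mem_nth.
- by rewrite -(mcoeff_span c i (uniq_mons d)) c0 mcoeff0.
- by exists (fun i => f@_(nth 0%MM (mons d) i)); apply: mpoly_span (uniq_mons d) fd.
Qed.

Lemma nonvanishing (q : {mpoly k[3]}) i :
  [pchar k] =i pred0 -> q \is i.-homog -> q != 0 ->
  exists v : 'I_3 -> k, v (inord 2) = 1 /\ q.@[v] != 0.
Proof.
move=> chark0 homq q0.
(* Substituting (t, t^(i+1), 1) sends the monomials of degree i to distinct
   powers of t. *)
pose w (l : 'I_3) := nth 0%N [:: 1; i.+1; 0]%N l.
pose U : {poly k} := \sum_(m <- msupp q) q@_m *: 'X^(\sum_l w l * m l).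
(* The weight is [m0 + (i+1) m1] with [m0 <= i], so division by [i+1] recovers both exponents; the
   degree gives the third. *)
have inj_w : {in msupp q &, injective (fun m : 'X_{1..3} => (\sum_l w l * m l)%N)}.
  have degq m : m \in msupp q -> mdeg m = i by apply: (dhomog_mf homq).
  move=> m m' /degq + /degq.
  rewrite !mdegE !big_ord_recl !big_ord0 /w /= !mul1n !mul0n !addn0 => d d' e.
  set m0 := m ord0 in d e *; set m0' := m' ord0 in d' e *.
  set m1 := m (lift ord0 ord0) in d e *; set m1' := m' (lift ord0 ord0) in d' e *.
  have le_m0 : (m0 < i.+1)%N by lia.
  have le_m0' : (m0' < i.+1)%N by lia.
  have [em1 em0] : m1 = m1' /\ m0 = m0'.
    have := edivn_eq m1 le_m0; rewrite mulnC addnC e addnC mulnC edivn_eq //.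
    by case.
  have em2 : m (lift ord0 (lift ord0 ord0)) = m' (lift ord0 (lift ord0 ord0)) by lia.
  apply/mnmP; case=> [[|[|[|//]]] lt].
  - by have -> : Ordinal lt = ord0 by apply: val_inj.
  - by have -> : Ordinal lt = lift ord0 ord0 by apply: val_inj.
  - by have -> : Ordinal lt = lift ord0 (lift ord0 ord0) by apply: val_inj.
have U0 : U != 0.
  have m0P := mlead_supp q0.
  apply/eqP => /(congr1 (fun p : {poly k} => p`_(\sum_l w l * mlead q l))).
  rewrite coef0 /U coef_sum (bigD1_seq (mlead q)) ?msupp_uniq //=.
  rewrite coefZ coefXn eqxx mulr1 big_seq_cond big1 ?addr0.
    by move/eqP; rewrite mcoeff_eq0 m0P.
  move=> m /andP[qm mq]; rewrite coefZ coefXn.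
  case: eqP => [e|]; last by rewrite mulr0.
  by rewrite (inj_w _ _ m0P qm e) eqxx in mq.
(* In characteristic zero the first [size U] naturals are distinct in [k], too many to be all roots
   of [U]. *)
have [t Ut] : exists t, U.[t] != 0.
  have [/allP ht|/allPn[t _ ?]] := boolP (all (root U) [seq n%:R | n <- iota 0 (size U)]).
    have := max_poly_roots U0 (introT allP ht); rewrite size_map size_iota ltnn.
    move=> h; suff : false by []; apply: h.
    rewrite map_inj_uniq ?iota_uniq // => a b e.
    wlog ab : a b e / (a <= b)%N.
      by case/orP: (leq_total a b) => le h; [|symmetry]; apply: h.
    have : (b - a)%:R == 0 :> k by rewrite natrB // e subrr.
    by rewrite (pcharf0P k).1 // subn_eq0 => ba; apply/eqP; rewrite eqn_leq ab.
  by exists t.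
exists (fun l => t ^+ w l); split; first by rewrite /w inordK.
suff -> : q.@[fun l => t ^+ w l] = U.[t] by [].
rewrite {1}(mpolyE q) raddf_sum /= horner_sum; apply: eq_bigr => m _.
rewrite mevalZ mevalX hornerZ hornerXn -prodrXr; congr (_ * _).
by apply: eq_bigr => l _; rewrite exprM.
Qed.

Lemma homogS_ind (P : {mpoly k[3]} -> Prop) d :
  (forall c f g, P f -> P g -> P (c *: f + g)) -> P 0 ->
  (forall (l : 'I_3) m, mdeg m = d -> P ('X_l * 'X_[m])) ->
  forall f, f \is d.+1.-homog -> P f.
Proof.
move=> PD P0 PX f /dhomog_mf homf; rewrite (mpolyE f) big_seq.
elim/big_ind: _ => // [f1 f2 Pf1 Pf2|m fm]; first by rewrite -[f1]scale1r; apply: PD.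
rewrite -[_ *: _]addr0; apply: PD => //.
have degm : mdeg m = d.+1 by apply: homf.
have [l ml] : exists l, (0 < m l)%N.
  apply/existsP/contraT; rewrite negb_exists => /forallP m0.
  by move: degm; rewrite mdegE big1 // => i _; apply/eqP; rewrite -leqn0 leqNgt.
have lem : (U_(l) <= m)%MM.
  by apply/mnm_lepP => j; rewrite mnm1E; case: eqP => // <-.
rewrite -(submK lem) addmC mpolyXD; apply: PX.
by have := mdegD (m - U_(l))%MM U_(l); rewrite submK // degm mdeg1 addn1; case.
Qed.

(** * Forms vanishing at a point of the plane *)

Variable v : 'I_3 -> k.
Hypothesis v2 : v (inord 2) = 1.

Definition lin (l : 'I_3) : {mpoly k[3]} := 'X_l - v l *: 'X_(inord 2).

Lemma homog_X (l : 'I_3) : ('X_l : {mpoly k[3]}) \is 1.-homog.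
Proof. by rewrite dhomogX /= mdeg1. Qed.

Lemma lin_homog l : lin l \is 1.-homog.
Proof. by rewrite rpredB ?rpredZ // homog_X. Qed.

Lemma meval_lin l : (lin l).@[v] = 0.
Proof. by rewrite /lin mevalB mevalZ !mevalXU v2 mulr1 subrr. Qed.

Definition modlin d (f : {mpoly k[3]}) := exists c (g : 'I_3 -> {mpoly k[3]}),
  (forall l, g l \is d.-homog) /\
  f = c *: 'X_(inord 2) ^+ d.+1 + \sum_l lin l * g l.

Lemma modlin_lin d c f g : modlin d f -> modlin d g -> modlin d (c *: f + g).
Proof.
move=> [a [f' [hf ->]]] [b [g' [hg ->]]].
exists (c * a + b), (fun l => c *: f' l + g' l).
split=> [l|]; first by rewrite rpredD ?rpredZ.
rewrite scalerDr scalerDl scalerA addrACA; congr (_ + _).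
rewrite scaler_sumr -big_split; apply: eq_bigr => l _ /=.
by rewrite mulrDr scalerAr.
Qed.

Lemma modlin_mul d l g : g \is d.-homog -> modlin d (lin l * g).
Proof.
move=> homg; exists 0, (fun j => if j == l then g else 0); split=> [j|].
  by case: ifP; rewrite ?rpred0.
rewrite scale0r add0r (bigD1 l) //= eqxx big1 ?addr0 // => j /negPf ->.
by rewrite mulr0.
Qed.

(** Modulo [lin l], the variable ['X_l] may be traded for [v l *: 'X_(inord 2)]. Doing so one factor
    at a time leaves only a power of the last variable. *)
Lemma homog_modlin d f : f \is d.+1.-homog -> modlin d f.
Proof.
have mod0 d' : modlin d' 0.
  by rewrite -(mulr0 (lin ord0)); apply: modlin_mul; rewrite rpred0.
elim: d f => [|d IH] f; apply: homogS_ind => //; try exact: modlin_lin;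
  move=> l m degm.
all: have homm : ('X_[m] : {mpoly k[3]}) \is (mdeg m).-homog by rewrite dhomogX.
all: rewrite degm in homm.
all: have -> : 'X_l * 'X_[m] = v l *: ('X_(inord 2) * 'X_[m]) + lin l * 'X_[m]
  by rewrite mulrBl scalerAl addrC subrK.
all: apply: modlin_lin; last exact: modlin_mul.
- have /eqP -> : m == 0%MM by rewrite -mdeg_eq0 degm.
  exists 1, (fun=> 0); split=> [j|]; first by rewrite rpred0.
  by rewrite big1 ?addr0 => [|j _]; rewrite ?mulr0 // mpolyX0 mulr1 scale1r.
- have [c [g [homg ->]]] := IH _ homm.
  exists c, (fun l => 'X_(inord 2) * g l); split=> [j|].
    by apply: (dhomogM (d := 1)); rewrite ?homog_X.
  rewrite mulrDr -scalerAr -exprS mulr_sumr; congr (_ + _).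
  by apply: eq_bigr => j _; rewrite mulrCA.
Qed.

(** Evaluation at [v] kills each [lin l] and sends the last variable to 1, so the coefficient of its
    power equals [f.@[v] = 0]. The third form [lin v (inord 2)] is itself zero. *)
Lemma vanish_lin d f : f \is d.+1.-homog -> f.@[v] = 0 ->
  exists g0 g1, [/\ g0 \is d.-homog, g1 \is d.-homog &
    f = lin (inord 0) * g0 + lin (inord 1) * g1].
Proof.
move=> /homog_modlin[c [g [homg ->]]] f0; exists (g (inord 0)), (g (inord 1)).
split=> //; have c0 : c = 0.
  rewrite -f0 mevalD mevalZ rmorphXn /= mevalXU v2 expr1n mulr1 raddf_sum /=.
  by rewrite big1 ?addr0 // => l _; rewrite mevalM meval_lin mul0r.
rewrite c0 scale0r add0r !big_ord_recl big_ord0 addr0.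
have -> : lift ord0 (lift ord0 ord0) = inord 2 :> 'I_3.
  by apply: val_inj; rewrite /= inordK.
have -> : lift ord0 ord0 = inord 1 :> 'I_3 by apply: val_inj; rewrite /= inordK.
have -> : ord0 = inord 0 :> 'I_3 by apply: val_inj; rewrite /= inordK.
by rewrite [lin (inord 2)]/lin v2 scale1r subrr mul0r addr0.
Qed.

End Polynomials.

(** * Graded quotients and their socles *)

Section Quotient.
Variables (k : fieldType) (I : idealr {mpoly k[3]}).
Implicit Types (a u : quot_alg I) (f g : {mpoly k[3]}).
Local Notation pr := (qproj I).

Lemma quot_mulZ a c u : a * (c *: u) = c *: (a * u).
Proof. exact: mulrCA. Qed.

Lemma qprojD f g : pr (f + g) = pr f + pr g. Proof. exact: raddfD. Qed.
Lemma qprojB f g : pr (f - g) = pr f - pr g. Proof. exact: raddfB. Qed.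
Lemma qprojM f g : pr (f * g) = pr f * pr g. Proof. exact: rmorphM. Qed.
Lemma qproj_sum (J : Type) (r : seq J) P (F : J -> {mpoly k[3]}) :
  pr (\sum_(j <- r | P j) F j) = \sum_(j <- r | P j) pr (F j).
Proof. exact: raddf_sum. Qed.

Definition qmul a : quot_alg I -> quot_alg I := *%R a.

Lemma qmul_linear a : linear (qmul a).
Proof. by move=> c u w; rewrite /qmul mulrDr quot_mulZ. Qed.

HB.instance Definition _ a := GRing.isLinear.Build k (quot_alg I) (quot_alg I) _
  (qmul a) (qmul_linear a).

Lemma graded_subspace d : subspace (@graded_piece k 3 I d).
Proof.
split; first by exists 0; rewrite ?rpred0 ?raddf0.
move=> c _ _ [f hf ->] [g hg ->]; exists (c *: f + g); last by rewrite qprojD qprojZ.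
by rewrite rpredD ?rpredZ.
Qed.

Lemma graded_mul d d' a f : graded_piece d a -> f \is d'.-homog ->
  graded_piece (d + d') (pr f * a).
Proof.
move=> [g hg ->] hf; exists (f * g); last by rewrite qprojM.
by rewrite addnC dhomogM.
Qed.

Lemma graded_mul1 d a f : graded_piece d a -> f \is 1.-homog ->
  graded_piece d.+1 (pr f * a).
Proof. by rewrite -[d.+1]addn1; apply: graded_mul. Qed.

(** The variables generate the maximal ideal: each monomial other than 1 is divisible by one of
    them. *)
Lemma socleP a : (forall l, a * pr 'X_l = 0) -> socle a.
Proof.
move=> aX _ [f f0 ->]; rewrite (mpolyE f) qproj_sum mulr_sumr big_seq.
apply: big1 => m fm; rewrite qprojZ quot_mulZ.
suff -> : a * pr 'X_[m] = 0 by rewrite scaler0.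
have [l lm] : exists l, (U_(l) <= m)%MM.
  have : m != 0%MM by apply: contraTneq fm => ->; rewrite -mcoeff_eq0 f0.
  rewrite -mdeg_eq0 mdegE sum_nat_eq0 negb_forall => /existsP[l ml].
  exists l; apply/mnm_lepP => j; rewrite mnm1E; case: eqP => // <-.
  by rewrite lt0n.
by rewrite -(submK lm) addmC mpolyXD qprojM mulrA aX mul0r.
Qed.

Lemma socle_mulX a f d : socle a -> f \is d.+1.-homog -> a * pr f = 0.
Proof.
move=> sa hf; apply: sa; exists f => //.
by apply: (dhomog_nemf_coeff hf); rewrite /= mdeg0.
Qed.

(** If forms of degree [n+1] kill [a], forms of degree [n] kill every [x_l a], which vanishes by
    induction. Then [a] is a socle element in a degree strictly between [i] and [e]. The base case
    is degree [e], where the form 1 kills [a]. *)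
Lemma nondegenerate i e a j n :
  (forall j a, (i < j < e)%N -> socle_piece j a -> a = 0) ->
  (i < j)%N -> (j + n)%N = e -> graded_piece j a ->
  (forall g, g \is n.-homog -> pr g * a = 0) -> a = 0.
Proof.
move=> nosoc; elim: n j a => [|n IH] j a ij jn Aa ga.
  by have := ga 1 (dhomog1 _ _); rewrite rmorph1 mul1r.
apply: (nosoc j); first by lia.
split=> //; apply: socleP => l; rewrite mulrC.
apply: (IH j.+1); [lia|lia| |move=> g hg].
  by apply: graded_mul1 => //; apply: homog_X.
by rewrite mulrA -qprojM ga // mulrC; apply: (dhomogM (d := 1)); rewrite ?homog_X.
Qed.

End Quotient.

(** * Upper bounds on dimensions forced by the socle *)

Section UpperBound.
Variables (k : fieldType) (A : sg_artinian k 3) (i d s : nat).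
Local Notation I := (sga_ideal A).
Local Notation pr := (qproj I).
Hypothesis chark0 : [pchar k] =i pred0.
Hypothesis e_id : sga_e A = (i + d.+1)%N.
Hypothesis lt_id : (i < d)%N.
Hypothesis dim_soci : has_dim (@socle_piece k 3 I i) s.
Hypothesis s_gt0 : (0 < s)%N.
Hypothesis dim_soce : has_dim (@socle_piece k 3 I (sga_e A)) 1.
Hypothesis nosoc : forall j (a : quot_alg I),
  (i < j < sga_e A)%N -> socle_piece j a -> a = 0.

(** The degree above the top is zero, so the whole top piece is socle. *)
Lemma dim_top : has_dim (@graded_piece k 3 I (sga_e A)) 1.
Proof.
apply: has_dim_iff dim_soce => a; split=> [[]//|Aa]; split=> //.
apply: socleP => l; apply: (@sga_top _ _ A (sga_e A).+1) => //.
by rewrite mulrC; apply: graded_mul1 => //; apply: homog_X.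
Qed.

(** A linear relation between the lifts would project to one between independent socle elements. *)
Lemma socle_lift : exists t : 'I_s -> {mpoly k[3]},
  [/\ forall j, t j \is i.-homog, forall j, socle (pr (t j)) &
   forall c : 'I_s -> k, \sum_j c j *: t j = 0 -> forall j, c j = 0].
Proof.
have [w [Uw free_w _]] := dim_soci.
have [t tP] := fin_all_exists2 (fun j => (Uw j).2).
move=> wt; exists t; split=> // [j|c tc0]; first by rewrite -wt; apply: (Uw j).1.
apply: free_w; under eq_bigr do rewrite wt -qprojZ.
by rewrite -qproj_sum tc0 raddf0.
Qed.

(** Pairing with [R_i] rather than [A_i] makes the second dimension a known binomial and puts the
    independent socle lifts into the right kernel. *)
Lemma dim_complement n : has_dim (@graded_piece k 3 I d.+1) n ->
  (n + s <= 'C(i + 2, 2))%N.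
Proof.
move=> dim_d; have [t [homt soct free_t]] := socle_lift.
apply: (pairing_dim (mu := fun a f => pr f * a) _ _ (graded_subspace _ _) dim_d
  (homog_dim _ _) dim_top _ _ homt free_t).
- by move=> f c u w; rewrite mulrDr quot_mulZ.
- move=> a c f g /=.
  by rewrite qprojD qprojZ mulrDl mulrC quot_mulZ mulrC.
- by move=> a f Aa hf; rewrite e_id addnC; apply: graded_mul.
- move=> a Aa a0; apply: (nondegenerate nosoc (j := d.+1) (n := i)) => //; lia.
- move=> a j [f hf ->]; rewrite mulrC.
  by rewrite mulrC; apply: socle_mulX hf.
Qed.

(** The two forms cut out a point where a socle form [q] does not vanish. Subtracting a multiple of
    [q] times a power of the last variable makes any [g] vanish there without changing its class. *)
Lemma two_generators : exists x y : {mpoly k[3]},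
  [/\ x \is 1.-homog, y \is 1.-homog & forall j g, (i <= j)%N -> g \is j.+1.-homog ->
    exists g0 g1, [/\ g0 \is j.-homog, g1 \is j.-homog &
      pr g = pr x * pr g0 + pr y * pr g1]].
Proof.
have [t [homt soct free_t]] := socle_lift.
pose q := t (Ordinal s_gt0).
have q0 : q != 0.
  apply/eqP => q0; pose j0 := Ordinal s_gt0.
  suff /free_t/(_ j0)/eqP : \sum_j (j == j0)%:R *: t j = 0 by rewrite eqxx oner_eq0.
  rewrite (bigD1 j0) //= -/q q0 scaler0 add0r big1 // => j /negPf ->.
  by rewrite scale0r.
have [v [v2 qv]] := nonvanishing chark0 (homt _) q0.
exists (lin v (inord 0)), (lin v (inord 1)); split; try exact: lin_homog.
(* The exponent is positive, so the socle class of [q] kills this power. *)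
move=> j g ij hg; pose w := q * 'X_(inord 2) ^+ (j - i).+1.
have homXn n : ('X_(inord 2) : {mpoly k[3]}) ^+ n \is n.-homog.
  by have := dhomogMn n (homog_X k (inord 2)); rewrite mul1n.
have homw : w \is j.+1.-homog.
  have -> : j.+1 = (i + (j - i).+1)%N by lia.
  by apply: dhomogM; [apply: homt|apply: homXn].
have wv : w.@[v] = q.@[v].
  by rewrite mevalM rmorphXn /= mevalXU v2 expr1n mulr1.
have prw : pr w = 0 by rewrite qprojM; apply: socle_mulX (soct _) (homXn _).
have homgw : g - (g.@[v] / q.@[v]) *: w \is j.+1.-homog by rewrite rpredB ?rpredZ.
have [|g0 [g1 [hg0 hg1 e]]] := vanish_lin v2 homgw.
  by rewrite mevalB mevalZ wv divfK // subrr.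
exists g0, g1; split=> //.
by rewrite -!qprojM -qprojD -e qprojB qprojZ prw scaler0 subr0.
Qed.

Lemma dim_concave n1 n2 n3 :
  has_dim (@graded_piece k 3 I d) n1 -> has_dim (@graded_piece k 3 I d.+1) n2 ->
  has_dim (@graded_piece k 3 I d.+2) n3 -> (n1 + n3 <= n2 + n2)%N.
Proof.
move=> dim1 dim2 dim3; have [x [y [homx homy gen]]] := two_generators.
have step f : f \is 1.-homog -> forall j u, graded_piece j u ->
    graded_piece j.+1 (qmul (pr f) u).
  by move=> homf j u Au; apply: graded_mul1.
apply: (koszul_dim (f := qmul (pr x)) (g := qmul (pr y)) (graded_subspace _ _) dim1 dim2 dim3);
  try by move=> u; apply: step.
- by move=> u; apply: mulrCA.
- move=> u Au xu yu.
  have {}xu : pr x * u = 0 := xu; have {}yu : pr y * u = 0 := yu.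
  (* Killed by [x] and [y], [u] is killed by all forms of degree [i+1]; since [d + (i+1) = e], this
     forces [u = 0]. *)
  apply: (nondegenerate nosoc (j := d) (n := i.+1)) => //; first by lia.
  move=> g homg; have [//|//|g0 [g1 [_ _ ->]]] := gen i g.
  by rewrite mulrDl (mulrAC (pr x)) (mulrAC (pr y)) xu yu !mul0r addr0.
- move=> _ [f homf ->]; have [|//|g0 [g1 [hg0 hg1 ->]]] := gen d.+1 f; first by lia.
  by exists (pr g0), (pr g1); split=> //; [exists g0|exists g1].
Qed.

End UpperBound.

(** * Monomial algebras *)

Section MonomialAlgebra.
Variable k : fieldType.

Variable bad : pred 'X_{1..3}.
Hypothesis bad0 : ~~ bad 0%MM.
Hypothesis badD : forall m m', bad m -> bad (m + m')%MM.

Definition mon_pred : pred {mpoly k[3]} := fun f => all bad (msupp f).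

Lemma mon_pred_closed : idealr_closed mon_pred.
Proof.
split; first by rewrite /in_mem /= /mon_pred msupp0.
  by rewrite /in_mem /= /mon_pred msupp1 /= andbT.
move=> a f g /allP bf /allP bg; apply/allP => m /msuppD_le.
rewrite mem_cat => /orP[/msuppM_le/allpairsP[[m1 m2] /= [_ fm2 ->]]|/bg //].
by rewrite addmC; apply/badD/bf.
Qed.

Definition mon_ideal : idealr {mpoly k[3]} :=
  HB.pack mon_pred (isIdealr.Build _ mon_pred mon_pred_closed).

Local Notation pr := (qproj mon_ideal).

Lemma mem_mon_ideal f : (f \in mon_ideal) = all bad (msupp f).
Proof. by []. Qed.

(** A combination of good monomials lies in the ideal only if its support is also bad, hence
    empty. *)
Lemma mon_dim (ms : seq 'X_{1..3}) : uniq ms -> all (predC bad) ms ->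
  has_dim (fun a => exists2 f, {subset msupp f <= ms} & a = pr f) (size ms).
Proof.
move=> uniq_ms good_ms; exists (fun i => pr 'X_[nth 0%MM ms i]); split=> [i|c|a].
- by exists 'X_[nth 0%MM ms i] => // m; rewrite msuppX inE => /eqP ->; rewrite mem_nth.
- under eq_bigr do rewrite -qprojZ.
  rewrite -qproj_sum => /eqP; rewrite qproj_eq0 mem_mon_ideal => /allP bf i.
  apply/eqP; rewrite -(mcoeff_span c i uniq_ms) mcoeff_eq0; apply/negP => /bf.
  by apply/negP; apply: (allP good_ms); apply: mem_nth.
- move=> [f fms ->]; exists (fun i => f@_(nth 0%MM ms i)).
  rewrite {1}(mpoly_span uniq_ms fms) qproj_sum.
  by apply: eq_bigr => i _; rewrite qprojZ.
Qed.

Lemma mon_reduce f : exists g,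
  [/\ {subset msupp g <= msupp f}, all (predC bad) (msupp g) & pr f = pr g].
Proof.
pose g : {mpoly k[3]} := \sum_(m <- msupp f | ~~ bad m) f@_m *: 'X_[m].
have gE m : g@_m = if bad m then 0 else f@_m.
  rewrite raddf_sum /= -big_filter.
  have -> : (if bad m then 0 else f@_m) =
            if m \in [seq m <- msupp f | ~~ bad m] then f@_m else 0.
    rewrite mem_filter; case: bad => //=; case: ifPn => //.
    exact: memN_msupp_eq0.
  case: ifPn => [fm|fm].
    rewrite (bigD1_seq m) ?filter_uniq //= mcoeffZ mcoeffX eqxx mulr1 big1 ?addr0 //.
    by move=> j /negPf jm; rewrite mcoeffZ mcoeffX jm mulr0.
  rewrite big_seq big1 // => j fj; rewrite mcoeffZ mcoeffX.
  by case: eqP => [e|]; rewrite ?mulr0 //; rewrite -e fj in fm.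
exists g; split.
- by move=> m; rewrite !mcoeff_msupp gE; case: bad; rewrite ?eqxx.
- by apply/allP => m; rewrite mcoeff_msupp gE /=; case: bad; rewrite ?eqxx.
apply/eqP; rewrite -subr_eq0 -qprojB qproj_eq0 mem_mon_ideal.
apply/allP => m; rewrite mcoeff_msupp mcoeffB gE.
by case: bad; rewrite // subrr eqxx.
Qed.

Lemma mon_graded_dim d :
  has_dim (@graded_piece k 3 mon_ideal d) (count (predC bad) (mons d)).
Proof.
rewrite -size_filter; apply: has_dim_iff (mon_dim _ (filter_all _ _)).
  move=> a; split=> [[f fd ->]|[f /homog_subset fd ->]].
    by exists f => //; apply/homog_subset => m /fd; rewrite mem_filter => /andP[].
  have [g [gf good_g ->]] := mon_reduce f; exists g => // m gm.
  by rewrite mem_filter; apply/andP; split; [apply: (allP good_g)|apply/fd/gf].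
exact/filter_uniq/uniq_basis.
Qed.

Definition mon_socle m := ~~ bad m && [forall l, bad (m + U_(l))%MM].

(** Multiplication by a variable shifts monomials injectively, so nothing cancels: each monomial of
    a reduced socle element is itself socle. *)
Lemma mon_socle_dim d :
  has_dim (@socle_piece k 3 mon_ideal d) (count mon_socle (mons d)).
Proof.
rewrite -size_filter; apply: has_dim_iff (mon_dim _ _).
- move=> a; split=> [[f fd ->]|[soca [f /homog_subset fd ea]]].
    split; last by exists f => //; apply/homog_subset => m /fd; rewrite mem_filter => /andP[].
    apply: socleP => l; rewrite -qprojM; apply/eqP; rewrite qproj_eq0 mem_mon_ideal.
    apply/allP => m; rewrite (perm_mem (msuppMX _ _)) => /mapP[m' /fd + ->].
    by rewrite mem_filter addmC => /andP[/andP[_ /forallP]].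
  have [g [gf good_g eg]] := mon_reduce f; exists g; last by rewrite ea.
  move=> m gm; rewrite mem_filter (fd _ (gf _ gm)) andbT.
  apply/andP; split; first exact: (allP good_g).
  apply/forallP => l; have /eqP : a * pr 'X_l = 0.
    by apply: soca; exists 'X_l => //; rewrite mcoeffX mnm1_eq0.
  rewrite ea eg -qprojM qproj_eq0 mem_mon_ideal => /allP; apply.
  by rewrite (perm_mem (msuppMX _ _)) addmC map_f.
- exact/filter_uniq/uniq_basis.
- by apply/allP => m; rewrite mem_filter => /andP[/andP[]].
Qed.

End MonomialAlgebra.

(** * Truncated monomial complete intersections *)

Section CompleteIntersection.

Local Notation i0 := (inord 0 : 'I_3).
Local Notation i1 := (inord 1 : 'I_3).
Local Notation i2 := (inord 2 : 'I_3).

Lemma ord3_ind (P : 'I_3 -> Prop) : P i0 -> P i1 -> P i2 -> forall l, P l.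
Proof.
move=> P0 P1 P2; case=> [[|[|[|//]]] lt].
- by have -> : Ordinal lt = i0 by apply: val_inj; rewrite /= inordK.
- by have -> : Ordinal lt = i1 by apply: val_inj; rewrite /= inordK.
- by have -> : Ordinal lt = i2 by apply: val_inj; rewrite /= inordK.
Qed.

Lemma eq_ord3 : ((i0 == i1) = false) * ((i0 == i2) = false) * ((i1 == i2) = false) *
  ((i1 == i0) = false) * ((i2 == i0) = false) * ((i2 == i1) = false).
Proof. by rewrite -!val_eqE /= !inordK. Qed.

Lemma mdeg3 (m : 'X_{1..3}) : mdeg m = (m i0 + m i1 + m i2)%N.
Proof.
rewrite mdegE !big_ord_recl big_ord0 addn0 addnA.
by congr (m _ + m _ + m _)%N; apply: val_inj; rewrite /= inordK.
Qed.

Lemma count_mons_bij d d' (a b : pred 'X_{1..3}) (f g : 'X_{1..3} -> 'X_{1..3}) :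
  (forall m, mdeg m = d -> a m -> [/\ mdeg (f m) = d', b (f m) & g (f m) = m]) ->
  (forall m, mdeg m = d' -> b m -> [/\ mdeg (g m) = d, a (g m) & f (g m) = m]) ->
  count a (mons d) = count b (mons d').
Proof.
move=> fP gP; rewrite -!size_filter -(size_map f); apply/perm_size/uniq_perm.
- rewrite map_inj_in_uniq ?filter_uniq ?uniq_mons // => m m'.
  rewrite !mem_filter !mem_mons => /andP[am /eqP dm] /andP[am' /eqP dm'] e.
  by have [_ _ <-] := fP m dm am; have [_ _ <-] := fP m' dm' am'; rewrite e.
- by rewrite filter_uniq ?uniq_mons.
move=> m; rewrite mem_filter mem_mons; apply/mapP/andP => [[m']|[bm /eqP dm]].
  by rewrite mem_filter mem_mons => /andP[am /eqP dm] ->; have [-> ->] := fP m' dm am.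
have [dg ag fg] := gP m dm bm; exists (g m) => //.
by rewrite mem_filter mem_mons ag dg /=.
Qed.

(** Dividing by the [p]-th power of the variable is a bijection onto the monomials of degree
    [d - p]; for [d < p] both sides vanish. *)
Lemma count_mons_ge (l : 'I_3) p d :
  count (fun m : 'X_{1..3} => p <= m l)%N (mons d) = 'C(d + 2 - p, 2).
Proof.
have le_deg (m : 'X_{1..3}) : (m l <= mdeg m)%N.
  by rewrite mdegE (bigD1 l) //= leq_addr.
have [pd|dp] := leqP p d; last first.
  rewrite bin_small; last by lia.
  apply/eqP; rewrite -leqn0 leqNgt -has_count; apply/hasPn => m.
  by rewrite mem_mons => /eqP dm; have := le_deg m; lia.
rewrite addnC -addnBA // addnC -size_mons -(count_predT (mons _)).
have addlE (m : 'X_{1..3}) : (m + U_(l) *+ p)%MM l = (m l + p)%N.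
  by rewrite mnmDE mulmnE mnm1E eqxx mul1n.
apply: (count_mons_bij (f := fun m => (m - U_(l) *+ p)%MM)
                       (g := fun m => (m + U_(l) *+ p)%MM)).
- move=> m dm pm; have le_m : (U_(l) *+ p <= m)%MM.
    apply/mnm_lepP => j; rewrite mulmnE mnm1E.
    by case: eqP => [<-|]; rewrite ?mul1n ?mul0n.
  have e := submK le_m; split=> //.
  by have := congr1 mdeg e; rewrite mdegD mdegMn mdeg1 dm; lia.
- move=> m dm _; split; last exact: addmK.
    by rewrite mdegD mdegMn mdeg1 dm; lia.
  by rewrite addlE leq_addl.
Qed.

Variables p q r : nat.

(** The monomial basis of the quotient by [(x^p, y^q, z^r)]. *)
Definition ci_basis : pred 'X_{1..3} := fun m => [&& m i0 < p, m i1 < q & m i2 < r]%N.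

(** Inclusion-exclusion: [j < r] makes the bound on the third exponent automatic, and [j < p + q]
    excludes divisibility by both [x^p] and [y^q]. *)
Lemma count_ci_low j : (j < r)%N -> (j < p + q)%N ->
  (count ci_basis (mons j) + 'C(j + 2 - p, 2) + 'C(j + 2 - q, 2))%N = 'C(j + 2, 2).
Proof.
move=> jr jpq; rewrite -(count_mons_ge i0) -(count_mons_ge i1) -addnA -count_predUI.
rewrite [X in (_ + X)%N]addnC (_ : count (predI _ _) _ = 0)%N ?add0n; last first.
  apply/eqP; rewrite -leqn0 leqNgt -has_count; apply/hasPn => m /=.
  by rewrite mem_mons mdeg3; lia.
rewrite -size_mons -(count_predC ci_basis); congr (_ + _)%N.
apply: eq_in_count => m /=; rewrite mem_mons mdeg3 /ci_basis => /eqP; lia.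
Qed.

Lemma count_ci_sym j j' : (0 < p)%N -> (0 < q)%N -> (0 < r)%N ->
  (j + j' + 3 = p + q + r)%N ->
  count ci_basis (mons j) = count ci_basis (mons j').
Proof.
move=> p0 q0 r0 jj'.
(* m |-> x^(p-1) y^(q-1) z^(r-1) / m *)
pose c (m : 'X_{1..3}) : 'X_{1..3} :=
  [multinom nth 0%N [:: p.-1 - m i0; q.-1 - m i1; r.-1 - m i2]%N l | l < 3].
have cE m : ((c m i0 = (p.-1 - m i0)%N) * (c m i1 = (q.-1 - m i1)%N) *
      (c m i2 = (r.-1 - m i2)%N))%type.
  by rewrite !mnmE !inordK.
apply: (count_mons_bij (f := c) (g := c)); move=> m dm /and3P[m0 m1 m2];
  rewrite mdeg3 in dm; rewrite mdeg3 /ci_basis !cE; (split; [lia|lia|]);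
  by apply/mnmP; apply: ord3_ind; rewrite !cE; lia.
Qed.

Variables (k : fieldType) (i e : nat).
Hypotheses (i_gt0 : (0 < i)%N) (p_gt0 : (0 < p)%N) (q_gt0 : (0 < q)%N).
Hypotheses (lt_ir : (i < r)%N) (lt_ipq : (i < p + q)%N) (lt_ie : (i < e)%N).
Hypothesis e_pqr : (e + 3 = p + q + r)%N.

(** Only the part of the ideal in degrees above [i] is kept, so monomials of degree [i] outside
    [ci_basis] survive as socle. *)
Definition ci_bad : pred 'X_{1..3} := fun m => (i < mdeg m)%N && ~~ ci_basis m.

Let bad0 : ~~ ci_bad 0%MM.
Proof. by rewrite /ci_bad mdeg0. Qed.

Let badD m m' : ci_bad m -> ci_bad (m + m')%MM.
Proof. by rewrite /ci_bad /ci_basis mdegD !mnmDE; lia. Qed.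

Local Notation I := (mon_ideal k bad0 badD).

Lemma ci_homog (f : {mpoly k[3]}) d : f \in I -> pihomog mdeg d f \in I.
Proof.
rewrite !mem_mon_ideal => /allP bf; apply/allP => m.
rewrite pihomogE mcoeff_msupp raddf_sum /= => nz.
have [fm|/memN_msupp_eq0 fm] := boolP (m \in msupp f); first exact: bf.
case/eqP: nz; rewrite big1 // => m' _; rewrite mcoeffZ mcoeffX.
by case: eqP => [->|]; rewrite ?fm ?mul0r ?mulr0.
Qed.

Lemma ci_nolin (f : {mpoly k[3]}) : f \is 1.-homog -> f \in I -> f = 0.
Proof.
move=> /dhomog_mf hf; rewrite mem_mon_ideal => /allP bf; apply/mpolyP => m.
rewrite mcoeff0; apply/memN_msupp_eq0/negP => fm.
have dm : mdeg m = 1%N by apply: hf.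
by have := bf _ fm; rewrite /ci_bad dm; lia.
Qed.

Definition ci_corner : 'X_{1..3} := [multinom nth 0%N [:: p.-1; q.-1; r.-1] l | l < 3].

Lemma ci_cornerE : ((ci_corner i0 = p.-1) * (ci_corner i1 = q.-1) * (ci_corner i2 = r.-1))%type.
Proof. by rewrite !mnmE !inordK. Qed.

Lemma ci_e_neq0 : exists2 a : quot_alg I, graded_piece e a & a != 0.
Proof.
exists (qproj I 'X_[ci_corner]).
  exists 'X_[ci_corner] => //; rewrite dhomogX /= mdeg3 !ci_cornerE; lia.
rewrite qproj_eq0 mem_mon_ideal msuppX /= /ci_bad /ci_basis !ci_cornerE; lia.
Qed.

Lemma ci_top j (a : quot_alg I) : (e < j)%N -> graded_piece j a -> a = 0.
Proof.
move=> ej [f /dhomog_mf hf ->]; apply/eqP; rewrite qproj_eq0 mem_mon_ideal.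
apply/allP => m fm; have : mdeg m = j by apply: hf.
by rewrite /ci_bad /ci_basis mdeg3; lia.
Qed.

Definition ci_algebra : sg_artinian k 3 := SGArtinian ci_homog ci_nolin ci_e_neq0 ci_top.

Definition socle_vector s : seq nat :=
  mkseq (fun j => if j == i then s else (j == e) : nat) e.+1.

Lemma ci_count_socle j : (j <= e)%N ->
  count (mon_socle ci_bad) (mons j) =
  if j == i then ('C(i + 2 - p, 2) + 'C(i + 2 - q, 2))%N else j == e.
Proof.
move=> je.
have socE m : mon_socle ci_bad m = ~~ ci_bad m &&
    [&& ci_bad (m + U_(i0))%MM, ci_bad (m + U_(i1))%MM & ci_bad (m + U_(i2))%MM].
  congr (_ && _); apply/forallP/and3P => [h|[b0 b1 b2]]; first by split; apply: h.
  exact: ord3_ind.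
case: eqP => [->|ji].
  (* In degree [i] the socle monomials are exactly those outside [ci_basis], so the two counts are
     complementary. *)
  apply/eqP; rewrite -(eqn_add2l (count ci_basis (mons i))) addnA count_ci_low //.
  rewrite -size_mons -(count_predC ci_basis) eqn_add2l; apply/eqP/eq_in_count => m.
  rewrite mem_mons socE /ci_bad /ci_basis !mdegD !mdeg1 !mnmDE !mnm1E !eqxx !eq_ord3 /= mdeg3; lia.
(* In any other degree only [ci_corner], of degree [e], can be socle, so the count is a membership
   test. *)
have -> : (j == e) = (ci_corner \in mons j) :> nat.
  by rewrite mem_mons mdeg3 !ci_cornerE; lia.
rewrite -count_uniq_mem ?uniq_mons //; apply: eq_in_count => m; rewrite mem_mons => dm.
rewrite socE; apply/idP/eqP => [|->].
  rewrite /ci_bad /ci_basis !mdegD !mdeg1 !mnmDE !mnm1E !eqxx !eq_ord3 => h.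
  apply/mnmP; apply: ord3_ind; rewrite ci_cornerE; move: h dm; rewrite mdeg3; lia.
by rewrite /ci_bad /ci_basis !mdegD !mdeg1 !mnmDE !mnm1E !eqxx !eq_ord3 !mdeg3 !ci_cornerE; lia.
Qed.

Lemma ci_socle_vector s : ('C(i + 2 - p, 2) + 'C(i + 2 - q, 2))%N = s ->
  is_socle_vector ci_algebra (socle_vector s).
Proof.
move=> sE; split; first by rewrite size_mkseq.
move=> j; rewrite size_mkseq ltnS => je; rewrite nth_mkseq // -sE -ci_count_socle //.
exact: mon_socle_dim.
Qed.

Definition ci_hvector : seq nat := mkseq (fun j => count (predC ci_bad) (mons j)) e.+1.

Lemma ci_hvectorP : is_hvector ci_algebra ci_hvector.
Proof.
split; first by rewrite size_mkseq.
move=> j; rewrite size_mkseq => je; rewrite nth_mkseq //.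
exact: mon_graded_dim.
Qed.

(** Above degree [i] the algebra agrees with the complete intersection, whose symmetry carries
    degree [e - j] to [j], within reach of [count_ci_low]. *)
Lemma nth_ci_hvector j : (i < e - j)%N -> (j <= i.+1)%N -> (j < r)%N -> (j < p + q)%N ->
  (nth 0 ci_hvector (e - j) + 'C(j + 2 - p, 2) + 'C(j + 2 - q, 2))%N = 'C(j + 2, 2).
Proof.
move=> ij ji jr jpq; rewrite nth_mkseq; last by lia.
rewrite -(count_ci_low jr jpq) -(@count_ci_sym (e - j) j) //; try lia.
congr (_ + _ + _)%N; apply: eq_in_count => m; rewrite mem_mons /ci_bad /=.
by case: (ci_basis m); lia.
Qed.

End CompleteIntersection.

(** * Sums of two triangular numbers *)

Lemma bin2S n : ('C(n.+1, 2) = 'C(n, 2) + n)%N.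
Proof. by rewrite binS bin1. Qed.

Lemma bin2_diff2 i : ('C(i + 3, 2) + 'C(i + 1, 2) = 2 * 'C(i + 2, 2) + 1)%N.
Proof. by rewrite !addnS addn0 !bin2S; lia. Qed.

Lemma bin2_sqr n : ('C(n, 2) * 2 + n = n * n)%N.
Proof. by elim: n => // n IH; rewrite bin2S; lia. Qed.

(* With K = 2 kap + 1 and N = 2 nu + 1 = K (4u^2 + 1), the numbers
   2a - 1 = K (4u^2 - 1) and 2b = 4uK satisfy (2a-1)^2 + (2b)^2 = N^2. *)
Lemma triangular_pair u kap nu : (1 < u)%N ->
  (nu.*2.+1 = kap.*2.+1 * (u * u * 4).+1)%N ->
  exists a b, [/\ (b < a)%N, a + kap.*2 = nu & 'C(a + b, 2) + 'C(a - b, 2) = nu * nu.+1]%N.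
Proof.
move=> u1 nuE; pose K := kap.*2.+1; pose X := (u * u * K)%N; pose b := (u * K * 2)%N.
(* From [u >= 2] come [b <= X] and [2K <= b]; hence [kap < X] and [b < 2X - kap = a]. *)
have uX : (u * K * 2 <= X)%N by rewrite /X [(u * u * K)%N]mulnAC leq_mul2l u1 orbT.
have KX : (K * 2 <= b)%N by rewrite /b leq_mul // leq_pmull //; lia.
have nuX : nu = (X * 2 + kap)%N by rewrite /X /K; nia.
have b2 : (b * b = 4 * X * K)%N by rewrite /b /X; nia.
exists (X * 2 - kap)%N, b.
have Ea : ((X * 2 - kap) + kap = X * 2)%N by lia.
move: (X * 2 - kap)%N Ea => a Ea.
have ba : (b < a)%N by lia.
split=> //; first by lia.
have := bin2_sqr (a + b); have := bin2_sqr (a - b).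
move: 'C(a - b, 2) 'C(a + b, 2) => x y.
(* Writing [a = c + b] removes truncated subtraction. Four times the goal, plus 1, is
   [(2a-1)^2 + (2b)^2 = (2 nu + 1)^2]. *)
have [c ac] : exists c, a = (c + b)%N by exists (a - b)%N; lia.
have -> : (a - b = c)%N by lia.
rewrite nuX /K in b2 *; nia.
Qed.

(** One odd product [N] splits as [K m * D m] for every [m], and [triangular_pair] with [u = m+2]
    applies to each splitting. *)
Lemma triangular_pairs M : exists nu (a b : 'I_M -> nat),
  [/\ injective a, forall m, (b m < a m <= nu)%N &
      forall m, ('C(a m + b m, 2) + 'C(a m - b m, 2) = nu * nu.+1)%N].
Proof.
pose D (m : 'I_M) := (m.+2 * m.+2 * 4).+1; pose N := (\prod_m D m)%N.
pose K (m : 'I_M) := (\prod_(l | l != m) D l)%N.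
have ND m : N = (K m * D m)%N by rewrite /N (bigD1 m) //= mulnC.
have oddD m : odd (D m) by rewrite /= oddM andbF.
have oddN : odd N by rewrite /N; elim/big_ind: _ => // x y; rewrite oddM => -> ->.
have oddK m : odd (K m) by move: oddN; rewrite (ND m) oddM => /andP[].
have half n : odd n -> n = n./2.*2.+1 by move=> on; rewrite -[LHS]odd_double_half on.
have NE (m : 'I_M) : N./2.*2.+1 = ((K m)./2.*2.+1 * (m.+2 * m.+2 * 4).+1)%N.
  by rewrite -!half // (ND m).
have [a aP] := fin_all_exists (fun m : 'I_M => triangular_pair (isT : (1 < m.+2)%N) (NE m)).
have [b bP] := fin_all_exists aP.
exists N./2, a, b; split=> [m m' e|m|m]; try by have [] := bP m; lia.
have [_ Em _] := bP m; have [_ Em' _] := bP m'.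
(* The relation [a + 2 kap = nu] recovers [K m] from [a m]; then [N = K m * D m] recovers [m]. *)
have EK : K m = K m' by rewrite (half _ (oddK m)) (half _ (oddK m')); lia.
have : (K m * D m == K m * D m')%N by rewrite -ND EK -ND.
rewrite eqn_pmul2l; last by rewrite (half _ (oddK m)).
by move/eqP; rewrite /D => e'; apply: val_inj => /=; nia.
Qed.

(** * Relative maxima *)

Section RelativeMaxima.
Variable k : fieldType.

Lemma hgeP h h' : reflect
  (size h = size h' /\ forall j, (nth 0 h' j <= nth 0 h j)%N) (hge h h').
Proof.
apply: (iffP idP) => [|[]].
  rewrite /hge; elim: h h' => [|x h IH] [|y h'] //= /andP[xy /IH[-> le_nth]].
  by split=> // -[].
rewrite /hge; elim: h h' => [|x h IH] [|y h'] //= [szE] le_nth.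
by rewrite (le_nth 0%N) IH // => j; apply: (le_nth j.+1).
Qed.

Lemma hge_trans h2 h1 h3 : hge h1 h2 -> hge h2 h3 -> hge h1 h3.
Proof.
move=> /hgeP[sz12 le12] /hgeP[sz23 le23]; apply/hgeP; split=> [|j]; first by rewrite sz12.
exact: leq_trans (le23 j) (le12 j).
Qed.

(** The sum of entries measures progress when climbing to larger vectors. *)
Lemma hge_sumn h h' : hge h h' -> h' != h -> (sumn h' < sumn h)%N.
Proof.
have le_sumn u v : hge u v -> (sumn v <= sumn u)%N.
  by elim: u v => [|x u IH] [|y v] //= /andP[xy /IH]; apply: leq_add.
rewrite /hge; elim: h h' => [|x h IH] [|y h'] //= /andP[xy hh'].
rewrite eqseq_cons negb_and => /orP[yx|/IH]; last first.
  by move=> /(_ hh'); rewrite -addnS; apply: leq_add.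
by rewrite -addSn; apply: leq_add; [rewrite ltn_neqAle yx|apply: le_sumn].
Qed.

Lemma graded_dim_le (I : idealr {mpoly k[3]}) j n :
  has_dim (@graded_piece k 3 I j) n -> (n <= 'C(j + 2, 2))%N.
Proof.
move=> [v [Av free_v _]]; have [t homt vt] := fin_all_exists2 Av.
apply: (free_le_dim (homog_dim k j) homt) => c tc0.
by apply: free_v; under eq_bigr do rewrite vt -qprojZ; rewrite -qproj_sum tc0 raddf0.
Qed.

Lemma hvector_sumn (A : sg_artinian k 3) h : is_hvector A h ->
  (sumn h <= \sum_(0 <= j < (sga_e A).+1) 'C(j + 2, 2))%N.
Proof.
move=> [szh hP]; rewrite sumnE (big_nth 0%N) szh big_nat [X in (_ <= X)%N]big_nat.
by apply: leq_sum => j /= je; apply/graded_dim_le/hP; rewrite szh.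
Qed.

(** Sums of admissible vectors are bounded in terms of [size s] alone, so climbing must stop. *)
Lemma below_relative_maximum s h : admissible k 3 s h ->
  exists2 h', relative_maximum k 3 s h' & hge h' h.
Proof.
pose B := (\sum_(0 <= j < size s) 'C(j + 2, 2))%N.
have bounded u : admissible k 3 s u -> (sumn u <= B)%N.
  by move=> [A [[szs _] /hvector_sumn]]; rewrite -szs.
have hge_refl u : hge u u by apply/hgeP.
have [n] := ubnP (B - sumn h); elim: n h => // n IH h lt_n adm.
have [max|] := classic (relative_maximum k 3 s h); first by exists h.
(* If no relative maximum lay above [h], [h] would be one itself: by induction, any admissible
   vector strictly above it lies below a relative maximum. *)
move=> nmax; apply: NNPP => no; apply: nmax; split=> // u admu uh.
case/orP=> [//|/andP[hgeuh _]]; case: no.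
have lt_hu : (sumn h < sumn u)%N by apply: hge_sumn; rewrite // eq_sym.
have [|//|h' maxh' h'u] := IH u; first by have := bounded u admu; lia.
by exists h' => //; apply: hge_trans h'u hgeuh.
Qed.

(** With [d = 2i + 2], twice [dim_complement] bounds the middle entry of [dim_concave]. *)
Lemma admissible_bounds i s h : [pchar k] =i pred0 -> (0 < i)%N -> (0 < s)%N ->
  admissible k 3 (socle_vector i (i * 3 + 3) s) h ->
  (nth 0 h (i * 2 + 2) + nth 0 h (i * 2 + 4) + 2 * s <= 2 * 'C(i + 2, 2))%N.
Proof.
move=> char0 i_gt0 s_gt0 [A [[szs sP] [szh hP]]].
have eA : sga_e A = (i + (i * 2 + 2).+1)%N.
  by move: szs; rewrite size_mkseq => -[<-]; lia.
have soc j : (j <= sga_e A)%N -> has_dim (@socle_piece k 3 (sga_ideal A) j)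
    (if j == i then s else j == sga_e A).
  move=> je; have := sP j; rewrite szs ltnS => /(_ je); rewrite nth_mkseq; last by lia.
  by have -> : (i * 3 + 3 = sga_e A)%N by lia.
have soci := soc i; rewrite eqxx in soci.
have soce := soc (sga_e A) (leqnn _).
have ei : (sga_e A == i) = false by lia.
rewrite ei eqxx in soce.
have nosoc j (a : quot_alg (sga_ideal A)) : (i < j < sga_e A)%N -> socle_piece j a -> a = 0.
  move=> /andP[ij je] Ua; have := soc j (ltnW je).
  have -> : (j == i) = false by lia.
  have -> : (j == sga_e A) = false by lia.
  by move=> [v [_ _ /(_ a Ua)[c ->]]]; rewrite big_ord0.
have h1 := hP (i * 2 + 2)%N; have h2 := hP (i * 2 + 2).+1.
have h3 := hP (i * 2 + 2).+2; rewrite szh in h1 h2 h3.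
have lt_i : (i < i * 2 + 2)%N by lia.
have si : has_dim (@socle_piece k 3 (sga_ideal A) i) s by apply: soci; lia.
have d2 := dim_complement eA lt_i si s_gt0 soce nosoc (h2 ltac:(lia)).
have d3 := dim_concave char0 eA lt_i si s_gt0 nosoc (h1 ltac:(lia)) (h2 ltac:(lia)) (h3 ltac:(lia)).
have -> : (i * 2 + 4 = (i * 2 + 2).+2)%N by lia.
by move: d2 d3; lia.
Qed.

Lemma admissible_ci i s a b : (0 < i)%N -> (b < a)%N -> (a * 2 <= i)%N ->
  ('C(a + b, 2) + 'C(a - b, 2) = s)%N ->
  exists A : sg_artinian k 3, is_socle_vector A (socle_vector i (i * 3 + 3) s) /\
  exists2 h, is_hvector A h & (nth 0 h (i * 2 + 2) + s + 2 * a = 'C(i + 3, 2) /\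
    nth 0 h (i * 2 + 4) + s + 2 = 'C(i + 1, 2) + 2 * a)%N.
Proof.
move=> i_gt0 ba ai sE.
have y1 : 'C(a + b, 2) = ('C((a + b).-1, 2) + (a + b).-1)%N.
  by rewrite -{1}(@prednK (a + b)%N) ?bin2S //; clear -ba; lia.
have y2 : 'C(a - b, 2) = ('C((a - b).-1, 2) + (a - b).-1)%N.
  by rewrite -{1}(@prednK (a - b)%N) ?bin2S //; clear -ba; lia.
(* Thus [i + 2 - p = a + b] and [i + 2 - q = a - b], giving socle dimension [s] in degree [i]; [r]
   is forced by [p + q + r = e + 3]. *)
pose p := (i + 2 - (a + b))%N; pose q := (i + 2 - (a - b))%N.
pose r := (i + 2 + a * 2)%N; pose e := (i * 3 + 3)%N.
have p_gt0 : (0 < p)%N by lia.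
have q_gt0 : (0 < q)%N by lia.
have lt_ir : (i < r)%N by lia.
have lt_ipq : (i < p + q)%N by lia.
have lt_ie : (i < e)%N by lia.
have e_pqr : (e + 3 = p + q + r)%N by lia.
exists (ci_algebra k i_gt0 p_gt0 q_gt0 lt_ir lt_ipq lt_ie e_pqr); split.
  apply: ci_socle_vector => //; rewrite -sE.
  by congr ('C(_, 2) + 'C(_, 2))%N; lia.
exists (ci_hvector p q r i e); first exact: ci_hvectorP.
have nth_h := nth_ci_hvector i_gt0 p_gt0 q_gt0 lt_ir lt_ipq lt_ie e_pqr.
(* The degrees [2i + 2] and [2i + 4] are dual to [i + 1] and [i - 1]. *)
have h1 := nth_h i.+1 ltac:(lia) ltac:(lia) ltac:(lia) ltac:(lia).
have h3 := nth_h i.-1 ltac:(lia) ltac:(lia) ltac:(lia) ltac:(lia).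
have E1 : (e - i.+1 = i * 2 + 2)%N by lia.
have E3 : (e - i.-1 = i * 2 + 4)%N by lia.
rewrite E1 in h1; rewrite E3 in h3.
have x1 : (i.+1 + 2 - p = (a + b).+1)%N.
  by rewrite /p; clear -i_gt0 ba ai; lia.
have x2 : (i.+1 + 2 - q = (a - b).+1)%N.
  by rewrite /q; clear -i_gt0 ba ai; lia.
have x3 : (i.-1 + 2 - p = (a + b).-1)%N.
  by rewrite /p; clear -i_gt0 ba ai; lia.
have x4 : (i.-1 + 2 - q = (a - b).-1)%N.
  by rewrite /q; clear -i_gt0 ba ai; lia.
have z1 : (i.+1 + 2 = i + 3)%N by lia.
rewrite x1 x2 z1 (bin2S (a + b)%N) (bin2S (a - b)%N) in h1.
rewrite x3 x4 in h3.
have z3 : (i.-1 + 2 = i + 1)%N by rewrite addn2 addn1 prednK.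
rewrite z3 in h3; clear -h1 h3 y1 y2 sE ba; lia.
Qed.

End RelativeMaxima.

Theorem theorem4p2 (k : fieldType) (chark0 : [pchar k]%R =i pred0)
    (M : nat) (hM : (0 < M)%N) :
  exists s : seq nat,
    (exists A : sg_artinian k 3, is_socle_vector A s) /\
    exists L : seq (seq nat),
      [/\ uniq L, (M < size L)%N
        & forall h, h \in L -> relative_maximum k 3 s h].
Proof.
have [nu [a [b [inj_a ab sE]]]] := triangular_pairs M.+1.
(* Since [a m <= nu], this choice gives [2 a m <= i]; [s] is the common sum of triangular
   numbers. *)
pose i := (nu * 2)%N; pose s := (nu * nu.+1)%N; pose sv := socle_vector i (i * 3 + 3) s.
have nu_gt0 : (0 < nu)%N by have := ab ord0; lia.
have i_gt0 : (0 < i)%N by lia.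
have s_gt0 : (0 < s)%N by rewrite muln_gt0 nu_gt0.
have ci m : exists A : sg_artinian k 3, is_socle_vector A sv /\
  exists2 h, is_hvector A h & (nth 0 h (i * 2 + 2) + s + 2 * a m = 'C(i + 3, 2) /\
    nth 0 h (i * 2 + 4) + s + 2 = 'C(i + 1, 2) + 2 * a m)%N.
  by have abm := ab m; apply: admissible_ci (sE m); lia.
exists sv; split; first by have [A [Asv _]] := ci ord0; exists A.
(* Passing to a maximum can only raise the two entries, so lower bounds are what survives. *)
have hmax m : exists2 h, relative_maximum k 3 sv h &
    ('C(i + 3, 2) <= nth 0 h (i * 2 + 2) + s + 2 * a m)%N &&
    ('C(i + 1, 2) + 2 * a m <= nth 0 h (i * 2 + 4) + s + 2)%N.
  have [A [Asv [h hA [h1 h3]]]] := ci m.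
  have adm : admissible k 3 sv h by exists A.
  have [h' maxh' /hgeP[_ le_h]] := below_relative_maximum adm.
  exists h' => //; have := le_h (i * 2 + 2)%N; have := le_h (i * 2 + 4)%N; lia.
have [H maxH HP] := fin_all_exists2 hmax.
exists [seq H m | m <- enum 'I_M.+1]; split; last by move=> h /mapP[m _ ->].
  (* Were [a m < a m'] with the same maximum, the first bound for [m] and the second for [m'] would
     add up to at least [2 'C(i+2, 2) + 1 - 2 s], against [admissible_bounds]. *)
  rewrite map_inj_uniq ?enum_uniq // => m m' eH; apply: inj_a.
  have := admissible_bounds chark0 i_gt0 s_gt0 (maxH m).1.
  have := HP m; have := HP m'; rewrite -eH.
  have := bin2_diff2 i; lia.
by rewrite size_map size_enum_ord.
Qed.
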